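(* Consider the Markov-modeled downlink with $N$ users and randomly delayed ARQ feedback described in the context (with $p>r$). For a slot $t\le m$, let $k_i$ denote the latest (most recent, i.e. smallest-index) slot $k>t$ from which feedback of user $i$ has arrived by the beginning of slot $t$, if any. Let $\mathcal{A}_t$ be the set of users $i$ having some arrived feedback with $f_{k_i}=1$, $\mathcal{N}_t$ the set of users $i$ having some arrived feedback with $f_{k_i}=0$, and $\mathcal{X}_t$ the set of users from whom no feedback has arrived by the beginning of slot $t$. (1) The greedy decision in slot $t$ is given by $$\hat a_t=\begin{cases}\arg\min_{i\in\mathcal{A}_t}k_i & \text{if }\mathcal{A}_t\ne\emptyset,\\ \arg\max_{i\in\mathcal{X}_t}\pi_m(i) & \text{if }\mathcal{A}_t=\emptyset,\ \mathcal{X}_t\neq\emptyset,\\ \arg\max_{i\in\mathcal{N}_t}k_i & \text{if }\mathcal{A}_t=\emptyset,\ \mathcal{X}_t=\emptyset.\end{cases}$$ (2) Order $\mathcal{A}_t$ by increasing $k_i$, $\mathcal{X}_t$ by decreasing $\pi_m(i)$, and $\mathcal{N}_t$ by decreasing $k_i$, and let $O_t$ be the concatenation of the ordered lists $\mathcal{A}_t,\mathcal{X}_t,\mathcal{N}_t$ in this order. Then $O_t$ lists the users in decreasing order of the beliefs $\pi_t(i)$; in particular its first element is a greedy decision in slot $t$. (3) The list $O_{t-1}$ is obtained from $O_t$ and the feedback $F_t$ arriving at the end of slot $t$ as follows: each user $a$ for which $F_t$ contains feedback originating from a slot that is the latest slot from which feedback of user $a$ is now available (so $k_a$ becomes that slot)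 is removed from its position and inserted in the sub-list $\mathcal{A}_{t-1}$ (if $f_{k_a}=1$) or $\mathcal{N}_{t-1}$ (if $f_{k_a}=0$) at the location consistent with the ordering by $k_i$; all other users are not moved. In particular, the greedy policy can be implemented without knowledge of $p$ and $r$ (other than $p>r$) and of the delay distribution.
   Context: Model. There are $N$ users. Time is slotted and slots are indexed in DEcreasing order $m,m-1,\ldots,1$, where $m$ is the horizon (slot $m$ is first, slot $1$ is last). The channel state of user $i$ in slot $t$ is $S_t(i)\in\{0,1\}$ ($1$ = ON, $0$ = OFF). The channels are independent across users, and each is a Markov chain with $P(S_t(i)=1\mid S_{t+1}(i)=1)=p$ and $P(S_t(i)=1\mid S_{t+1}(i)=0)=r$, with $p,r\in[0,1]$ and $p>r$. Initially $P(S_m(i)=1)=\pi_m(i)$. Scheduling and feedback. In each slot $t$ the scheduler schedules exactly one user $a_t\in\{1,\ldots,N\}$. The scheduled user generates the ARQ feedback bit $f_t=S_t(a_t)$ ($1$=ACK, $0$=NACK), which arrives, without error and stamped with its originating slot, at the end of slot $t-D(a_t,t)$ (delay $0$ means it arrives at the end of slot $t$ itself). The delays $D(i,t)$ are i.i.d. across users and time with a probability mass function on $\{0,1,2,\ldots\}$ and independent of the channels; feedback may arrive out of order. $F_t$ denotes the collection of all (time-stamped) feedback arriving at the end of slot $t$. Beliefs. Let $T(x)=xp+(1-x)r$, $T^0(x)=x$, $T^u=T\circ T^{u-1}$. The belief $\pi_t(i)$ is the probability that user $i$'s channel is ON in slot $t$ given all feedback that has arrived by the beginning of slot $t$: if $k>t$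 is the latest slot from which feedback of user $i$ has arrived, then $\pi_t(i)=T^{k-t}(f_k)$; if no feedback of user $i$ has arrived, $\pi_t(i)=T^{m-t}(\pi_m(i))$. Greedy policy. In each slot $t$ the greedy policy schedules a user maximizing $\pi_t(i)$ over $i$. When beliefs are equal, any order among the tied users is admissible (''decreasing'' means non-increasing). *)

(* Defs.v *)
From HB Require Import structures.
From mathcomp Require Import all_boot all_order all_algebra.
From mathcomp Require Import all_classical all_reals all_analysis.

Set Implicit Arguments.
Unset Strict Implicit.
Unset Printing Implicit Defensive.

Import Order.TTheory GRing.Theory Num.Theory.

Local Open Scope classical_set_scope.
Local Open Scope ring_scope.

(* Slots are natural numbers and run downwards: slot m is first, slot 1 is
   last.  So "before slot t" means "index > t", and the latest of several
   slots is the one with the smallest index. *)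

Section Feedback.
Variable N : nat.

(* (i, k, f): bit f (true = ACK) originating from user i in slot k. *)
Definition feedback := ('I_N * nat * bool)%type.
Definition fb_user (x : feedback) : 'I_N := x.1.1.
Definition fb_slot (x : feedback) : nat := x.1.2.
Definition fb_bit (x : feedback) : bool := x.2.

(* In what follows H is the collection of all feedback that has arrived so
   far. *)

(* The most recent feedback of user i in H, as Some (k_i, f_{k_i}). *)
Definition latest (H : seq feedback) (i : 'I_N) : option (nat * bool) :=
  omap (fun x => (fb_slot x, fb_bit x))
    (ohead (sort (fun x y => (fb_slot x <= fb_slot y)%N)
                 [seq x <- H | fb_user x == i])).

(* k_i; the value 0 for users without feedback is junk. *)
Definition latest_slot (H : seq feedback) (i : 'I_N) : nat :=
  if latest H i is Some (k, _) then k else 0%N.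

Definition acked (H : seq feedback) : {set 'I_N} :=
  [set i | if latest H i is Some (_, f) then f else false]%SET.

Definition nacked (H : seq feedback) : {set 'I_N} :=
  [set i | if latest H i is Some (_, f) then ~~ f else false]%SET.

Definition unheard (H : seq feedback) : {set 'I_N} :=
  [set i | latest H i == None]%SET.

End Feedback.

Section Beliefs.
Variables (R : realType) (N : nat).

Definition T1 (p r x : R) : R := x * p + (1 - x) * r.

Definition belief (p r : R) (m : nat) (pim : 'I_N -> R)
    (t : nat) (H : seq (feedback N)) (i : 'I_N) : R :=
  if latest H i is Some (k, f) then iter (k - t) (T1 p r) (f%:R)
  else iter (m - t) (T1 p r) (pim i).

Definition is_greedy (p r : R) (m : nat) (pim : 'I_N -> R)
    (t : nat) (H : seq (feedback N)) (i : 'I_N) : Prop :=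
  forall j, belief p r m pim t H j <= belief p r m pim t H i.

(* The three-case rule; it reads pim and the time stamps only, and leaves
   open how ties in an arg min or arg max are broken. *)
Definition greedy_rule (pim : 'I_N -> R) (H : seq (feedback N)) (i : 'I_N) :
    Prop :=
  let k := latest_slot H in
  if acked H != finset.set0 then
    i \in acked H /\ forall j, j \in acked H -> (k i <= k j)%N
  else if unheard H != finset.set0 then
    i \in unheard H /\ forall j, j \in unheard H -> pim j <= pim i
  else
    i \in nacked H /\ forall j, j \in nacked H -> (k j <= k i)%N.

Record sublists := Sublists {
  listA : seq 'I_N; listX : seq 'I_N; listN : seq 'I_N }.

Definition full_list (L : sublists) : seq 'I_N := listA L ++ listX L ++ listN L.

(* L is an admissible choice of the three ordered sub-lists of O_t. *)
Definition is_ordering (pim : 'I_N -> R) (H : seq (feedback N))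
    (L : sublists) : Prop :=
  let k := latest_slot H in
  [/\ perm_eq (listA L) (enum (acked H)) /\
        sorted (fun i j => (k i <= k j)%N) (listA L),
      perm_eq (listX L) (enum (unheard H)) /\
        sorted (fun i j => pim j <= pim i) (listX L)
    & perm_eq (listN L) (enum (nacked H)) /\
        sorted (fun i j => (k j <= k i)%N) (listN L) ].

(* Insertion in front of the first element b with le a b. *)
Fixpoint insert (le : rel 'I_N) (a : 'I_N) (s : seq 'I_N) : seq 'I_N :=
  if s is b :: s' then if le a b then a :: s else b :: insert le a s'
  else [:: a].

(* F holds feedback of user a from the slot that is the latest one once F has
   been added to H. *)
Definition is_moved (H F : seq (feedback N)) (a : 'I_N) : bool :=
  if latest (F ++ H) a is Some (k, f) then (a, k, f) \in F else false.

Definition update (H F : seq (feedback N)) (L : sublists) : sublists :=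
  let k := latest_slot (F ++ H) in
  let moved := [seq a <- enum 'I_N | is_moved H F a] in
  let stay s := [seq b <- s | ~~ is_moved H F b] in
  Sublists
    (foldr (insert (fun i j => (k i <= k j)%N)) (stay (listA L))
           [seq a <- moved | a \in acked (F ++ H)])
    (stay (listX L))
    (foldr (insert (fun i j => (k j <= k i)%N)) (stay (listN L))
           [seq a <- moved | a \in nacked (F ++ H)]).

End Beliefs.

Section Model.
Context {R : realType} {N : nat} {d : measure_display} {T : measurableType d}
  {P : probability T R}.

(* S t i: channel state of user i in slot t (true = ON);
   D i t: delay of the feedback of user i originating from slot t;
   a t: user scheduled in slot t. *)
Implicit Types (S : nat -> 'I_N -> {RV P >-> bool})
  (D : 'I_N -> nat -> {RV P >-> nat}) (a : nat -> T -> 'I_N).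

Record downlink (m : nat) (p r : R) (pim : 'I_N -> R) (q : probability nat R)
    S D : Prop := Downlink {
  channel_init : forall i, P [set w | S m i w] = (pim i)%:E;
  (* P(S_t = 1 | S_{t+1} = x_{t+1}, ..., S_m = x_m) depends on x_{t+1} only,
     multiplied out so as not to divide by 0 *)
  channel_markov : forall i t (x : nat -> bool), (0 < t < m)%N ->
    (P [set w | S t i w /\ forall s, (t < s <= m)%N -> S s i w = x s] =
     (if x t.+1 then p else r)%:E *
     P [set w | forall s, (t < s <= m)%N -> S s i w = x s])%E;
  delay_law : forall i t n, (0 < t <= m)%N -> P [set w | D i t w = n] = q [set n];
  (* the N trajectories (S_1(i), ..., S_m(i)) and the N * m delays are mutually
     independent; the ordinal k stands for slot k.+1 *)
  independence : forall (B : 'I_N -> set {ffun 'I_m -> bool})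
      (C : 'I_N -> 'I_m -> set nat),
    (P [set w | (forall i, B i [ffun k : 'I_m => S k.+1 i w]) /\
                forall i k, C i k (D i k.+1 w)] =
     (\prod_(i < N) P [set w | B i [ffun k : 'I_m => S k.+1 i w]]) *
     (\prod_(i < N) \prod_(k < m) P [set w | C i k (D i k.+1 w)]))%E }.

(* F_t: the feedback from slot k arrives at the end of slot k - D(a_k, k), and
   never if that is not a positive number. *)
Definition arriving (m : nat) S D a (t : nat) (w : T) : seq (feedback N) :=
  [seq (a k w, k, S k (a k w) w) | k <- iota 1 m & k == (t + D (a k w) k w)%N].

(* [:: F_{t+1}; ...; F_m], what the scheduler has seen by the beginning of
   slot t *)
Definition history (m : nat) S D a (t : nat) (w : T) :
    seq (seq (feedback N)) :=
  [seq arriving m S D a s w | s <- iota t.+1 (m - t)].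

Definition arrived (m : nat) S D a (t : nat) (w : T) : seq (feedback N) :=
  flatten (history m S D a t w).

(* The slot t can be read off a history from its length m - t. *)
Definition follows (sched : seq (seq (feedback N)) -> 'I_N) (m : nat) S D a :
    Prop :=
  forall t w, (0 < t <= m)%N -> a t w = sched (history m S D a t w).

Definition cond_prob (E G : set T) : R := fine (P (E `&` G)) / fine (P G).

End Model.

(* Main.v *)
Require Import Defs.
From mathcomp Require Import all_boot all_order all_algebra.
From mathcomp Require Import all_classical all_reals all_analysis.
From mathcomp Require Import lra zify.

(* Since r < p, the map T is increasing, so T^u(1) decreases and T^u(0)
   increases in u, and T^u(0) <= T^v(x) <= T^u(1) whenever u <= v and x lies in
   [0, 1]; moreover T^u(0) <= T^v(1) for all u and v.  Hence the order of the
   beliefs can be read off the time stamps and the initial beliefs.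

   That the beliefs are conditional probabilities rests on the observation that
   a history up to slot t determines the users scheduled in the slots > t.  With
   these users fixed, the event of that history is a rectangle in the
   independent channel trajectories and delays, so conditioning on it amounts,
   for user i, to conditioning on the states revealed by the feedback of i, and
   the Markov property leaves only the latest of these. *)

Import Order.TTheory GRing.Theory Num.Theory.

Local Open Scope classical_set_scope.
Local Open Scope ring_scope.

(** * The most recent feedback of a user, and the effect of new arrivals on it *)

Section Latest.
Context {N : nat}.
Implicit Types (H F : seq (feedback N)) (i : 'I_N).

Lemma latest_none H i :
  latest H i = None <-> forall x, x \in H -> fb_user x != i.
Proof.
rewrite /latest; set s := sort _ _.
have sE x : (x \in s) = (fb_user x == i) && (x \in H).
  by rewrite mem_sort mem_filter.
case: s sE => [|y s] sE /=.
  split=> // _ x xH; apply/negP => xi.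
  by have := sE x; rewrite xi xH.
split=> // /(_ y); have := sE y; rewrite mem_head => /esym/andP[-> yH].
by move=> /(_ yH).
Qed.

Lemma latest_some H i k f : latest H i = Some (k, f) ->
  (i, k, f) \in H /\ forall x, x \in H -> fb_user x = i -> (k <= fb_slot x)%N.
Proof.
rewrite /latest; set s := sort _ _.
have sE x : (x \in s) = (fb_user x == i) && (x \in H).
  by rewrite mem_sort mem_filter.
have : sorted (fun x y : feedback N => (fb_slot x <= fb_slot y)%N) s.
  by apply: sort_sorted => x y; apply: leq_total.
case: s sE => [|y s] sE //= sy [<- <-].
have := sE y; rewrite mem_head => /esym/andP[/eqP yi yH].
split; first by rewrite -yi; case: (y) yH => [[? ?] ?].
move=> x xH /eqP xi; have := sE x; rewrite xi xH inE => /orP[/eqP->//|xs].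
apply: (allP (order_path_min _ sy)) => // a b c.
exact: leq_trans.
Qed.

(** [latest] sorts by slot only, so conflicting bits from one user and slot would make its value
    depend on the order of [H]. *)
Definition consistent H := forall x y, x \in H -> y \in H ->
  fb_user x = fb_user y -> fb_slot x = fb_slot y -> fb_bit x = fb_bit y.

Lemma latest_eq H i k f : consistent H -> (i, k, f) \in H ->
  (forall x, x \in H -> fb_user x = i -> (k <= fb_slot x)%N) ->
  latest H i = Some (k, f).
Proof.
move=> cH kH kmin; case E : (latest H i) => [[k' f']|]; last first.
  by move/latest_none: E => /(_ _ kH); rewrite eqxx.
have [k'H k'min] := latest_some H i k' f' E.
have kk : k' = k.
  apply/eqP; rewrite eqn_leq (k'min _ kH erefl).
  exact: (kmin _ k'H erefl).
rewrite kk in k'H *.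
by rewrite (cH _ _ kH k'H erefl erefl : f = f').
Qed.

(** If the latest item of [F ++ H] is not in [F], it lies in [H] and is minimal there too;
    [consistent] then settles the bit. *)
Lemma latest_cat_stay H F i : consistent (F ++ H) -> ~~ is_moved H F i ->
  latest (F ++ H) i = latest H i.
Proof.
move=> cFH; rewrite /is_moved.
case E : (latest (F ++ H) i) => [[k f]|].
  move=> kF; have [kFH kmin] := latest_some _ _ _ _ E.
  move: kFH; rewrite mem_cat (negbTE kF) => kH.
  apply/esym/latest_eq => //.
    by move=> x y xH yH; apply: cFH; rewrite mem_cat ?xH ?yH orbT.
  by move=> x xH; apply: kmin; rewrite mem_cat xH orbT.
move=> _; apply/esym/latest_none => x xH.
by move/latest_none: E; apply; rewrite mem_cat xH orbT.
Qed.

Lemma moved_heard H F i : is_moved H F i -> latest (F ++ H) i != None.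
Proof. by rewrite /is_moved; case: latest. Qed.

(** One case analysis on [statusP] fixes the three memberships, [latest] and [latest_slot] together;
    it also shows that the three sets partition the users. *)
Variant status_spec H i : bool -> bool -> bool -> option (nat * bool) -> nat ->
    Prop :=
  | StatusAcked k of latest H i = Some (k, true) :
      status_spec H i true false false (Some (k, true)) k
  | StatusUnheard of latest H i = None :
      status_spec H i false true false None 0%N
  | StatusNacked k of latest H i = Some (k, false) :
      status_spec H i false false true (Some (k, false)) k.

Lemma statusP H i :
  status_spec H i (i \in acked H) (i \in unheard H) (i \in nacked H)
    (latest H i) (latest_slot H i).
Proof.
rewrite !inE /latest_slot; case E : (latest H i) => [[k []]|] /=;
  by constructor.
Qed.

End Latest.

(** * Insertion into a sorted list *)

Section Insertion.
Context {N : nat}.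
Variable le : rel 'I_N.
Hypotheses (le_total : total le) (le_trans : transitive le).

Lemma perm_foldr_insert s u : perm_eq (foldr (insert le) s u) (u ++ s).
Proof.
have perm_insert a v : perm_eq (insert le a v) (a :: v).
  elim: v => [|b v IHv] //=; case: ifP => // _.
  rewrite -(perm_cons b) in IHv; apply: (perm_trans IHv).
  by rewrite (perm_catCA [:: b] [:: a] v).
elim: u => [|a u IHu] //=; apply: (perm_trans (perm_insert _ _)).
by rewrite perm_cons.
Qed.

Lemma sorted_foldr_insert s u : sorted le s -> sorted le (foldr (insert le) s u).
Proof.
move=> ss; elim: u => [|a u] //=; move: (foldr _ _ _) => {ss s u}.
case=> [|b v] //=; case: ifPn => [/= -> -> //|].
(* By totality, an element that the insertion passes over lies below the inserted one. *)
have leC x y : ~~ le x y -> le y x by case/orP: (le_total x y) => ->.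
elim: v b => [|c v IHv] b /=; first by move=> /leC ->.
move=> /leC ba /andP[bc cv]; case: ifPn => ac /=; first by rewrite ba ac cv.
by rewrite bc; apply: IHv.
Qed.

End Insertion.

(** * Maintaining the three ordered sub-lists *)

Section Update.
Context {R : realType} {N : nat}.
Variable pim : 'I_N -> R.
Implicit Types (H F : seq (feedback N)) (L : sublists N).

(** Serves [acked] and [nacked] alike: [A] and [A'] are the set before and after the arrivals, and
    only the users marked by [mv] can change membership. *)
Lemma perm_update (A A' : {set 'I_N}) (mv : pred 'I_N) s :
  (forall i, ~~ mv i -> (i \in A') = (i \in A)) -> perm_eq s (enum A) ->
  perm_eq ([seq i <- [seq i <- enum 'I_N | mv i] | i \in A'] ++
           [seq i <- s | ~~ mv i]) (enum A').
Proof.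
move=> AA' sA; apply: uniq_perm.
- rewrite cat_uniq; apply/and3P; split.
  + by do 2! apply: filter_uniq; apply: enum_uniq.
  + apply/hasPn => i; rewrite mem_filter => /andP[/negbTE mi _].
    by rewrite -filter_predI mem_filter /= mi andbF.
  + by apply: filter_uniq; rewrite (perm_uniq sA) enum_uniq.
- exact: enum_uniq.
move=> i; rewrite (mem_enum A') -filter_predI mem_cat.
rewrite (mem_filter (predI _ _)) (mem_filter (fun j => ~~ mv j)) (perm_mem sA).
rewrite !mem_enum /= inE andbT.
by case: (boolP (mv i)) => [|/AA' ->] /=; rewrite ?andbT ?andbF ?orbF.
Qed.

Lemma update_ordering H F L : consistent (F ++ H) ->
  is_ordering pim H L -> is_ordering pim (F ++ H) (update H F L).
Proof.
move=> cFH [[pA sA] [pX sX] [pN sN]].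
have lS i : ~~ is_moved H F i -> latest (F ++ H) i = latest H i.
  exact: latest_cat_stay.
have kS : {in predC (is_moved H F), latest_slot (F ++ H) =1 latest_slot H}.
  by move=> i /lS E; rewrite /latest_slot E.
split; split=> /=.
- apply: (perm_trans (perm_foldr_insert _ _ _)); apply: perm_update pA => i /lS E.
  by rewrite !inE E.
- apply: sorted_foldr_insert => [i j|]; first exact: leq_total.
  (* Unmoved users keep their time stamps, so on them the new order is the old one. *)
  rewrite (eq_in_sorted (P := predC (is_moved H F))
    (e' := fun i j => (latest_slot H i <= latest_slot H j)%N)); last 2 first.
  + by move=> i j ii jj; rewrite !kS.
  + exact: filter_all.
  by apply: sorted_filter sA => ? ? ?; apply: leq_trans.
- apply: uniq_perm => [||i].
  + by apply: filter_uniq; rewrite (perm_uniq pX) enum_uniq.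
  + exact: enum_uniq.
  rewrite (mem_enum (unheard _)) mem_filter (perm_mem pX) mem_enum !inE.
  (* A moved user has feedback, so [unheard] can only lose users. *)
  case: (boolP (is_moved H F i)) => [/moved_heard/negbTE-> //|/lS -> //].
- by apply: sorted_filter sX => ? ? ? /[swap]; apply: le_trans.
- apply: (perm_trans (perm_foldr_insert _ _ _)); apply: perm_update pN => i /lS E.
  by rewrite !inE E.
- apply: sorted_foldr_insert => [i j|]; first exact: leq_total.
  rewrite (eq_in_sorted (P := predC (is_moved H F))
    (e' := fun i j => (latest_slot H j <= latest_slot H i)%N)); last 2 first.
  + by move=> i j ii jj; rewrite !kS.
  + exact: filter_all.
  by apply: sorted_filter sN => ? ? ? /[swap]; apply: leq_trans.
Qed.

Lemma ordering_exists H : exists L, is_ordering pim H L.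
Proof.
pose k := latest_slot H.
exists (Sublists (sort (fun i j => (k i <= k j)%N) (enum (acked H)))
  (sort (fun i j => pim j <= pim i) (enum (unheard H)))
  (sort (fun i j => (k j <= k i)%N) (enum (nacked H)))).
split; split=> /=; rewrite ?perm_sort //; apply: sort_sorted => i j.
- exact: leq_total.
- exact: le_total.
- exact: leq_total.
Qed.

Lemma ordering_perm H L : is_ordering pim H L ->
  perm_eq (full_list L) (enum 'I_N).
Proof.
case=> [[pA _] [pX _] [pN _]].
have memL i : (i \in listA L, i \in listX L, i \in listN L) =
    (i \in acked H, i \in unheard H, i \in nacked H).
  by rewrite (perm_mem pA) (perm_mem pX) (perm_mem pN) !mem_enum.
apply: uniq_perm; rewrite ?enum_uniq //; last first.
  move=> i; have [mA mX mN] := memL i; rewrite !mem_cat mA mX mN mem_enum.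
  by case: statusP.
rewrite !cat_uniq (perm_uniq pA) (perm_uniq pX) (perm_uniq pN) !enum_uniq /=.
rewrite andbT; apply/andP; split; apply/hasPn => i; have [mA mX mN] := memL i.
  by rewrite mem_cat mA mX mN; case: statusP.
by rewrite mX mN; case: statusP.
Qed.

End Update.

(** * Comparing beliefs through time stamps and initial beliefs *)

Section BeliefOrder.
Context {R : realType} {N : nat}.
Variables (p r : R) (m : nat) (pim : 'I_N -> R).
Hypotheses (hp : 0 <= p <= 1) (hr : 0 <= r <= 1) (hrp : r < p).
Hypothesis hpim : forall i, 0 <= pim i <= 1.

Let iT u := iter u (T1 p r).

(** [T1] is affine with slope [p - r], which is positive. *)
Lemma le_iterT1 u x y : x <= y -> iT u x <= iT u y.
Proof.
move=> xy; elim: u => //= u; rewrite /iT /=.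
move: (iter u _ x) (iter u _ y) => {xy}x' {}y' xy'.
have : 0 <= (y' - x') * (p - r) by rewrite mulr_ge0 ?subr_ge0 // ltW.
by rewrite /T1; lra.
Qed.

Lemma iterT1_01 u x : 0 <= x <= 1 -> 0 <= iT u x <= 1.
Proof.
move=> x01; elim: u => //= u; rewrite /iT /=; move: (iter u _ x) => y.
case/andP: hp => p0 p1; case/andP: hr => r0 r1 /andP[y0 y1].
rewrite -subr_ge0 in y1.
have yp : y * p <= y by rewrite ler_piMr.
have yr : (1 - y) * r <= 1 - y by rewrite ler_piMr.
rewrite /T1 addr_ge0 ?mulr_ge0 //=; lra.
Qed.

(** [iT v x] is [iT u] applied to [iT (v - u) x], which is at most 1, so monotonicity suffices. *)
Lemma iterT1_from1 u v x : 0 <= x <= 1 -> (u <= v)%N -> iT v x <= iT u 1.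
Proof.
move=> x01 uv; rewrite -(subnKC uv) /iT iterD; apply: le_iterT1.
by have /andP[] := iterT1_01 (v - u) x x01.
Qed.

Lemma iterT1_from0 u v x : 0 <= x <= 1 -> (u <= v)%N -> iT u 0 <= iT v x.
Proof.
move=> x01 uv; rewrite -(subnKC uv) /iT iterD; apply: le_iterT1.
by have /andP[] := iterT1_01 (v - u) x x01.
Qed.

Variables (t : nat) (H : seq (feedback N)).
Hypothesis slotsH : forall x, x \in H -> (t <= fb_slot x <= m)%N.

Let b := belief p r m pim t H.

(* User i may stand before user j in the list O_t. *)
Definition precedes (i j : 'I_N) : bool :=
  [|| [&& i \in acked H, j \in acked H & (latest_slot H i <= latest_slot H j)%N],
      (i \in acked H) && (j \notin acked H),
      [&& i \in unheard H, j \in unheard H & pim j <= pim i],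
      (i \in unheard H) && (j \in nacked H)
    | [&& i \in nacked H, j \in nacked H &
        (latest_slot H j <= latest_slot H i)%N]].

Lemma precedes_belief i j : precedes i j -> b j <= b i.
Proof.
have h0 : 0 <= (0 : R) <= 1 by rewrite lexx ler01.
have h1 : 0 <= (1 : R) <= 1 by rewrite lexx ler01.
have bnd x k f : latest H x = Some (k, f) -> (t <= k <= m)%N.
  by case/latest_some => /slotsH.
rewrite /precedes /b /belief.
case: (statusP H i) => [k Ei|Ei|k Ei]; case: (statusP H j) => [l Ej|Ej|l Ej];
  rewrite //= ?orbF ?andbF => le_ij;
  try have /andP[tk km] := bnd _ _ _ Ei; try have /andP[tl lm] := bnd _ _ _ Ej.
- by apply: iterT1_from1 => //; apply: leq_sub2r.
- by apply: iterT1_from1 => //; apply: leq_sub2r.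
(* For an ACK against a NACK the two slots may come in either order; the bound to use is the one
   from the side with fewer iterations. *)
- have [kl|/ltnW lk] := leqP k l.
    by apply: iterT1_from1 => //; apply: leq_sub2r.
  by apply: iterT1_from0 => //; apply: leq_sub2r.
- exact: le_iterT1.
- by apply: iterT1_from0 => //; apply: leq_sub2r.
- by apply: iterT1_from0 => //; apply: leq_sub2r.
Qed.

(** The chosen user [precedes] every user: it is extremal in its own class, and the classes placed
    before it are empty. *)
Lemma greedy_rule_greedy i : greedy_rule pim H i -> is_greedy p r m pim t H i.
Proof.
move=> gi j; apply: precedes_belief; move: gi; rewrite /greedy_rule /precedes.
case: ifPn => [_ [iA /(_ j)]|/negPn/eqP A0].
  by rewrite iA /=; case: (j \in acked H) => //= ->.
have nA x : (x \in acked H) = false by rewrite A0 inE.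
rewrite !nA /=; case: ifPn => [_ [iX /(_ j)]|/negPn/eqP X0].
  rewrite iX /=; move: (nA j); case: (statusP H j) => //=.
  by move=> _ _ ->.
have nX x : (x \in unheard H) = false by rewrite X0 inE.
rewrite !nX /= => -[-> /(_ j)]; move: (nA j) (nX j).
by case: (statusP H j) => //= k _ _ _ ->.
Qed.

Lemma ordering_sorted L : is_ordering pim H L ->
  sorted (fun i j => b j <= b i) (full_list L).
Proof.
case=> [[pA sA] [pX sX] [pN sN]].
have memA i : (i \in listA L) = (i \in acked H).
  by rewrite (perm_mem pA) mem_enum.
have memX i : (i \in listX L) = (i \in unheard H).
  by rewrite (perm_mem pX) mem_enum.
have memN i : (i \in listN L) = (i \in nacked H).
  by rewrite (perm_mem pN) mem_enum.
(* The [pairwise] form splits along the concatenation into conditions within and between the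
   sub-lists, each of which is checked for [precedes]. *)
rewrite sorted_pairwise; last by move=> ? ? ? /[swap]; apply: le_trans.
apply: (sub_in_pairwise (P := predT) (r := precedes)).
- by move=> i j _ _; apply: precedes_belief.
- exact: all_predT.
rewrite !pairwise_cat; apply/and3P; split; last (apply/and3P; split).
- apply/allrelP => i j; rewrite mem_cat memA memX memN /precedes => ->.
  by case: (statusP H j).
- rewrite sorted_pairwise in sA; last by move=> ? ? ?; apply: leq_trans.
  apply: (sub_in_pairwise (P := fun i => i \in listA L)) sA; last exact/allP.
  move=> i j ii jj; have {ii jj} : (i \in acked H) && (j \in acked H).
    by rewrite -!memA; apply/andP.
  by move=> /andP[+ + ij]; rewrite /precedes ij => -> ->; rewrite ?orbT.
- apply/allrelP => i j; rewrite memX memN /precedes => -> ->.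
  by rewrite /= !orbT.
- rewrite sorted_pairwise in sX; last by move=> ? ? ? /[swap]; apply: le_trans.
  apply: (sub_in_pairwise (P := fun i => i \in listX L)) sX; last exact/allP.
  move=> i j ii jj; have {ii jj} : (i \in unheard H) && (j \in unheard H).
    by rewrite -!memX; apply/andP.
  by move=> /andP[+ + ij]; rewrite /precedes ij => -> ->; rewrite ?orbT.
- rewrite sorted_pairwise in sN; last by move=> ? ? ? /[swap]; apply: leq_trans.
  apply: (sub_in_pairwise (P := fun i => i \in listN L)) sN; last exact/allP.
  move=> i j ii jj; have {ii jj} : (i \in nacked H) && (j \in nacked H).
    by rewrite -!memN; apply/andP.
  by move=> /andP[+ + ij]; rewrite /precedes ij => -> ->; rewrite ?orbT.
Qed.

End BeliefOrder.

(** * Existence of a greedy decision *)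

Section Rule.
Context {R : realType} {N : nat}.
Variable pim : 'I_N -> R.

Lemma ordering_head_greedy p r m t (H : seq (feedback N)) L : (0 < N)%N ->
  is_ordering pim H L ->
  sorted (fun i j => belief p r m pim t H j <= belief p r m pim t H i)
    (full_list L) ->
  exists2 i, ohead (full_list L) = Some i & is_greedy p r m pim t H i.
Proof.
move=> N0 /ordering_perm pL; have memL j : j \in full_list L.
  by rewrite (perm_mem pL) mem_enum.
case: (full_list L) memL => [|i s] memL /= si.
  by have := memL (Ordinal N0).
exists i => // j; have := memL j; rewrite inE => /predU1P[->//|js].
move: si => /order_path_min/allP; apply=> // ? ? ? /[swap].
exact: le_trans.
Qed.

Lemma greedy_rule_exists (H : seq (feedback N)) : (0 < N)%N ->
  exists i, greedy_rule pim H i.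
Proof.
move=> N0; rewrite /greedy_rule.
have [/finset.set0Pn[i iA]|A0] := boolP (acked H != finset.set0).
  by case: (arg_minnP (latest_slot H) iA) => i0 iA0 min; exists i0.
have [/finset.set0Pn[i iA]|X0] := boolP (unheard H != finset.set0).
  by case: (arg_maxP pim iA) => i0 iA0 max; exists i0.
(* With no ACKed and no unheard user, every user is NACKed, in particular this one. *)
have iN : Ordinal N0 \in nacked H.
  move/negPn/eqP: A0 => A0; move/negPn/eqP: X0 => X0.
  have : (Ordinal N0 \in acked H) = false by rewrite A0 inE.
  have : (Ordinal N0 \in unheard H) = false by rewrite X0 inE.
  by case: statusP.
by case: (arg_maxnP (latest_slot H) iN) => i0 iN0 max; exists i0.
Qed.

End Rule.

(** * What has arrived, and what a history reveals *)

Section Arrivals.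
Context {R : realType} {N : nat} {d : measure_display} {T : measurableType d}
  {P : probability T R}.
Variables (m : nat) (S : nat -> 'I_N -> {RV P >-> bool})
  (D : 'I_N -> nat -> {RV P >-> nat}) (a : nat -> T -> 'I_N).

Lemma mem_arriving t w x : reflect
  (exists2 k, (0 < k <= m)%N && (k == t + D (a k w) k w)%N &
     x = (a k w, k, S k (a k w) w))
  (x \in arriving m S D a t w).
Proof.
apply: (iffP mapP) => -[k]; rewrite ?mem_filter ?mem_iota => hk ->;
  exists k => //; rewrite ?mem_filter ?mem_iota; lia.
Qed.

(** Feedback from slot [k] must arrive in a slot [k - D] greater than [t]; the additive form avoids
    truncated subtraction. *)
Lemma mem_arrived t w x : reflect
  (exists2 k, (t + D (a k w) k w < k <= m)%N & x = (a k w, k, S k (a k w) w))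
  (x \in arrived m S D a t w).
Proof.
apply: (iffP flatten_mapP) => [[s]|[k hk ->]].
  rewrite mem_iota => hs /mem_arriving[k hk ->]; exists k => //; lia.
exists (k - D (a k w) k w)%N; first by rewrite mem_iota; lia.
by apply/mem_arriving; exists k => //; lia.
Qed.

(** Only one user is scheduled per slot, so the slot alone determines the bit. *)
Lemma arrived_consistent t w : consistent (arrived m S D a t w).
Proof.
move=> _ _ /mem_arrived[k _ ->] /mem_arrived[l _ ->] _.
by rewrite /fb_slot /= => ->.
Qed.

Lemma arrived_slots t w x :
  x \in arrived m S D a t w -> (t <= fb_slot x <= m)%N.
Proof. by case/mem_arrived => k hk ->; rewrite /fb_slot /=; lia. Qed.

Lemma arrived_pred t w : (0 < t <= m)%N ->
  arrived m S D a t.-1 w = arriving m S D a t w ++ arrived m S D a t w.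
Proof.
case: t => // t tm; rewrite /arrived /history /=.
by have -> : (m - t = (m - t.+1).+1)%N by lia.
Qed.

Lemma history_eqP t v w :
  history m S D a t v = history m S D a t w <->
  forall s, (t < s <= m)%N -> arriving m S D a s v = arriving m S D a s w.
Proof.
split=> [/eq_in_map hE s hs|hE]; first by apply: hE; rewrite mem_iota; lia.
by apply/eq_in_map => s; rewrite mem_iota => hs; apply: hE; lia.
Qed.

Variable sched : seq (seq (feedback N)) -> 'I_N.
Hypothesis aE : follows sched m S D a.

(* The histories seen by a scheduler determine its own past decisions, so that
   in the event of a given history the latter can be treated as constants. *)
Lemma history_eq t v w : (0 < t)%N ->
  history m S D a t v = history m S D a t w <->
  forall k, (t < k <= m)%N -> let i := a k w in
    if (t + D i k w < k)%N then D i k v = D i k w /\ S k i v = S k i w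
    else ~~ (t + D i k v < k)%N.
Proof.
move=> t0; split=> [/history_eqP hE k hk|hE].
  have [i iE] : exists i, i = a k w by exists (a k w).
  rewrite -iE /=.
  (* The histories up to slot [t] contain those up to the earlier slot [k], so the scheduler took
     the same decision there. *)
  have ak : a k v = i.
    rewrite iE !aE; try lia; congr sched; apply/history_eqP => s hs.
    by apply: hE; lia.
  case: ifPn => hD.
    have /mem_arriving[l hl [_ kl]] :
        (i, k, S k i w) \in arriving m S D a (k - D i k w)%N v.
      by rewrite hE; last lia; apply/mem_arriving; exists k; rewrite -?iE //; lia.
    by rewrite -kl ak in hl * => ->; split=> //; lia.
  apply/negP => hv.
  have /mem_arriving[l hl [_ kl _]] :
      (i, k, S k i v) \in arriving m S D a (k - D i k v)%N w.
    by rewrite -hE; last lia; apply/mem_arriving; exists k; rewrite ak //; lia.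
  by rewrite -kl -iE in hl; lia.
(* Induction from slot [m] downwards: equal arrivals after slot [s] give equal decisions in all
   slots from [s] on, and only feedback from those slots can arrive in [s]. *)
have aux n s : (t < s <= m)%N -> (m - s < n)%N ->
    arriving m S D a s v = arriving m S D a s w.
  elim: n s => // n IHn s hs sn.
  have ak k : (s <= k <= m)%N -> a k v = a k w.
    move=> hk; rewrite !aE; try lia; congr sched; apply/history_eqP => s' hs'.
    by apply: IHn; lia.
  have fE k : (0 < k <= m)%N ->
      (k == s + D (a k v) k v)%N = (k == s + D (a k w) k w)%N.
    move=> hk; have [ks|sk] := ltnP k s; first by lia.
    rewrite ak; last by lia.
    have /= := hE k ltac:(lia); case: ifP => hD; last by lia.
    by case=> -> _.
  rewrite /arriving; have -> : [seq k <- iota 1 m | (k == s + D (a k v) k v)%N] =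
      [seq k <- iota 1 m | (k == s + D (a k w) k w)%N].
    by apply: eq_in_filter => k; rewrite mem_iota => hk; apply: fE; lia.
  apply/eq_in_map => k; rewrite mem_filter mem_iota => hk.
  rewrite ak; last by lia.
  have /= := hE k ltac:(lia); case: ifP => hD; last by lia.
  by case=> _ ->.
apply/history_eqP => s hs; exact: (aux (m - s).+1).
Qed.

End Arrivals.

(** * The Markov property of a single channel *)

Section Channel.
Context {R : realType} {N : nat} {d : measure_display} {T : measurableType d}
  {P : probability T R}.

Lemma prob_partition (I : finType) (f : T -> I) (A : set T) :
  measurable A -> (forall x, measurable (f @^-1` [set x])) ->
  P A = (\sum_x P (A `&` f @^-1` [set x]))%E.
Proof.
move=> mA mf; have AE :
    A = \bigcup_(x in [set` index_enum I]) (A `&` f @^-1` [set x]).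
  apply/seteqP; split=> [w Aw|w [x _ []//]].
  by exists (f w) => //=; apply: mem_index_enum.
rewrite {1}AE measure_fin_bigcup.
- by rewrite -fsbig_seq ?index_enum_uniq.
- exact: finite_seq.
- by move=> x y _ _ [w [[_ <-] [_ <-]]].
- by move=> x _; apply: measurableI.
Qed.

Variables (m : nat) (p r : R) (pim : 'I_N -> R) (q : probability nat R)
  (S : nat -> 'I_N -> {RV P >-> bool}) (D : 'I_N -> nat -> {RV P >-> nat}).
Hypothesis hdl : downlink m p r pim q S D.

(** Says that [E] is a union of atoms of the states of [i] before slot [t] in time; it stands in for
    membership in the sigma-algebra of that past. *)
Definition determined_after i t (E : set T) := forall v w,
  (forall s, (t < s <= m)%N -> S s i v = S s i w) -> E v -> E w.

Lemma measurable_agree i (Q : set nat) (x : nat -> bool) :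
  measurable [set v | forall s, Q s -> S s i v = x s].
Proof.
have -> : [set v | forall s, Q s -> S s i v = x s] =
    \bigcap_(s in Q) (S s i @^-1` [set x s]) by [].
by apply: bigcap_measurableType => s _; apply: measurable_funPTI.
Qed.

(** [channel_markov] speaks of one complete past trajectory. Splitting [E] into such atoms and
    summing extends it to all events of the past, since [S t.+1 i] is constant on each atom. *)
Lemma markov_event i t (E : set T) : (0 < t < m)%N -> measurable E ->
  determined_after i t E ->
  P ([set w | S t i w] `&` E) =
  (p%:E * P (E `&` [set w | S t.+1 i w]) +
   r%:E * P (E `&` [set w | ~~ S t.+1 i w]))%E.
Proof.
move=> tm mE detE.
have mS s b : measurable [set w | S s i w = b].
  exact: (measurable_funPTI (S s i) (Y := [set b])).
have mSn s : measurable [set w | ~~ S s i w].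
  rewrite (_ : [set w | _] = [set w | S s i w = false]) //.
  by apply/seteqP; split=> w /=; [move/negbTE | move=> ->].
(* Ordinal [k] stands for slot [k.+1], so the test [t <= k] keeps exactly the states in slots
   greater than [t]. *)
pose f w := [ffun k : 'I_m => (t <= k)%N && S k.+1 i w].
pose atom w0 := [set w | forall s, (t < s <= m)%N -> S s i w = S s i w0].
have fE w0 : f @^-1` [set f w0] = atom w0.
  apply/seteqP; split=> w /=.
    move=> /ffunP fww s /andP[ts sm].
    have sm1 : (s.-1 < m)%N by lia.
    have := fww (Ordinal sm1); rewrite !ffunE /= prednK; last by lia.
    by have -> : (t <= s.-1)%N by lia.
  move=> ww; apply/ffunP => k; rewrite !ffunE.
  by case: leqP => //= tk; rewrite ww // ltnS tk /=.
have f0 x : (forall w, f w <> x) -> f @^-1` [set x] = set0.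
  by move=> fx; apply/seteqP; split=> // w /fx.
have mf x : measurable (f @^-1` [set x]).
  have [[w0 <-]|/forallNP/f0 ->] := pselect (exists w, f w = x).
    by rewrite fE; apply: measurable_agree.
  exact: measurable0.
rewrite (prob_partition _ f) //; last exact: measurableI (mS _ true) mE.
rewrite (prob_partition _ f (E `&` [set w | S t.+1 i w])) //; last first.
  exact: measurableI mE (mS _ true).
rewrite (prob_partition _ f (E `&` [set w | ~~ S t.+1 i w])) //; last first.
  exact: measurableI mE (mSn _).
rewrite !ge0_sume_distrr // -big_split; apply: eq_bigr => x _ /=.
have [[w0 <-{x}]|/forallNP/f0 ->] := pselect (exists w, f w = x); last first.
  by rewrite !setI0 measure0 !mule0 adde0.
(* An atom either lies inside [E] or misses it. *)
rewrite fE; have [Ew0|nEw0] := pselect (E w0); last first.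
  have EI0 A : E `&` A `&` atom w0 = set0.
    apply/seteqP; split=> // w [[Ew _] ww0]; apply: nEw0.
    exact: detE Ew.
  by rewrite (setIC [set w | S t i w]) !EI0 measure0 !mule0 adde0.
have atomE w : atom w0 w -> E w.
  by move=> ww0; apply: detE Ew0 => s hs; rewrite ww0.
have atomS w : atom w0 w -> S t.+1 i w = S t.+1 i w0 by apply; lia.
have -> : [set w | S t i w] `&` E `&` atom w0 = [set w | S t i w /\ atom w0 w].
  by apply/seteqP; split=> w; [case=> -[] | case=> ? /[dup]/atomE].
have /= -> := channel_markov hdl i (fun s => S s i w0) tm.
have -> : E `&` [set w | S t.+1 i w] `&` atom w0 =
    if S t.+1 i w0 then atom w0 else set0.
  apply/seteqP; split=> w; first by case=> -[_ /=] + /[dup] ? /atomS <- => ->.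
  case: ifP => // Sw0 /[dup]/[dup] /atomE Ew /atomS Sw ww0.
  by split=> //; split=> //=; rewrite Sw.
have -> : E `&` [set w | ~~ S t.+1 i w] `&` atom w0 =
    if S t.+1 i w0 then set0 else atom w0.
  apply/seteqP; split=> w.
    by case=> -[_ /=] + /[dup] ? /atomS <- => /negbTE ->.
  case: ifP => // Sw0 /[dup]/[dup] /atomE Ew /atomS Sw ww0.
  by split=> //; split=> //=; rewrite Sw Sw0.
by case: (S t.+1 i w0); rewrite measure0 !mule0 ?adde0 ?add0e.
Qed.

(** Each slot applies [T1] once to the conditional probability, starting from [b] in slot [k]. With
    [k.-1], the event [E] may itself fix the state in slot [k]. *)
Lemma markov_iterate i t k b (E : set T) : (0 < t <= k)%N -> (k <= m)%N ->
  measurable E -> determined_after i k.-1 E ->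
  P ([set w | S k i w] `&` E) = (b%:E * P E)%E ->
  P ([set w | S t i w] `&` E) = ((iter (k - t) (T1 p r) b)%:E * P E)%E.
Proof.
move=> /andP[t0 tk] km mE detE bE.
have aux n u : (0 < u)%N -> k = (u + n)%N ->
    P ([set w | S u i w] `&` E) = ((iter n (T1 p r) b)%:E * P E)%E.
  elim: n u => [|n IHn] u u0 kE; first by rewrite addn0 in kE; rewrite -kE.
  rewrite markov_event //=; last 2 first.
  - by lia.
  - by move=> v w vw; apply: detE => s hs; apply: vw; lia.
  have := IHn u.+1 isT ltac:(lia); rewrite setIC; move: (iter n _ b) => c {IHn}.
  (* With the induction hypothesis this gives the OFF part mass [(1 - c) * P E], so the [p] and [r]
     terms add up to [T1 p r c]. *)
  have : P E = (P (E `&` [set w | S u.+1 i w]) +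
      P (E `&` [set w | ~~ S u.+1 i w]))%E.
    rewrite (prob_partition _ (S u.+1 i)) // => [|x]; last first.
      exact: measurable_funPTI.
    rewrite big_bool; congr (P _ + P (_ `&` _))%E.
    by apply/seteqP; split=> w /= => [->//|/negbTE].
  have fineP A : measurable A -> P A = (fine (P A))%:E.
    by move=> mA; rewrite fineK ?fin_num_measure.
  have mS : measurable (E `&` [set w | S u.+1 i w]).
    apply: measurableI => //.
    exact: (measurable_funPTI (S u.+1 i) (Y := [set true])).
  have mSN : measurable (E `&` [set w | ~~ S u.+1 i w]).
    rewrite (_ : [set w | ~~ _] = [set w | S u.+1 i w = false]).
      apply: measurableI => //.
      exact: (measurable_funPTI (S u.+1 i) (Y := [set false])).
    by apply/seteqP; split=> w /=; [move/negbTE | move=> ->].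
  rewrite (fineP _ mSN) (fineP _ mS) (fineP _ mE).
  rewrite -!EFinM -!EFinD => -[PE] [PS]; congr _%:E.
  by rewrite /T1 PS; move: PE; rewrite PS; nra.
by apply: aux => //; lia.
Qed.

Section Conditioning.
Variables (i : 'I_N) (t : nat) (w : T) (heard : nat -> bool).
Hypothesis ht : (0 < t <= m)%N.

(** What conditioning on the history of [w] leaves for the trajectory of [i]; [heard] will mark the
    slots whose feedback of [i] has arrived. *)
Definition heard_event : set T :=
  [set v | forall s, (t < s <= m)%N -> heard s -> S s i v = S s i w].

Lemma measurable_heard_event : measurable heard_event.
Proof.
rewrite (_ : heard_event = [set v | forall s, ((t < s <= m)%N && heard s) ->
    S s i v = S s i w]); first exact: measurable_agree.
apply/seteqP; split=> v hv s; first by move=> /andP[]; apply: hv.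
by move=> h1 h2; apply: hv; rewrite h1.
Qed.

(** The event is the whole space, so the iteration starts in slot [m] from the initial law. *)
Lemma cond_unheard : (forall s, (t < s <= m)%N -> ~~ heard s) ->
  P ([set v | S t i v] `&` heard_event) =
  ((iter (m - t) (T1 p r) (pim i))%:E * P heard_event)%E.
Proof.
move=> nh; have hE : heard_event = setT.
  by apply/seteqP; split=> // v _ s /nh/negbTE->.
apply: markov_iterate => //.
- exact: measurable_heard_event.
- by rewrite hE.
- by rewrite hE setIT probability_setT mule1 (channel_init hdl).
Qed.

(** As [k] is the latest heard slot, the event depends on slots from [k] up only. It fixes the state
    in slot [k], so the iteration starts from 0 or 1. *)
Lemma cond_heard k : (t < k <= m)%N -> heard k ->
  (forall s, (t < s < k)%N -> ~~ heard s) ->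
  P ([set v | S t i v] `&` heard_event) =
  ((iter (k - t) (T1 p r) (S k i w)%:R)%:E * P heard_event)%E.
Proof.
move=> hk kh nh; apply: markov_iterate => //.
- by lia.
- by lia.
- exact: measurable_heard_event.
- move=> u v uv hu s hs sh; rewrite -hu // -uv //.
  by have := nh s; rewrite sh; lia.
case Skw : (S k i w).
  rewrite mul1e; congr (P _); apply/seteqP; split=> v; first by case.
  by move=> hv; split=> //=; rewrite hv.
rewrite mul0e (_ : _ `&` _ = set0) ?measure0 //.
by apply/seteqP; split=> // v [/= + /(_ k hk kh)]; rewrite Skw => ->.
Qed.

End Conditioning.

End Channel.

(** * Beliefs as conditional probabilities *)

Section ConditionalBelief.
Context {R : realType} {N : nat} {d : measure_display} {T : measurableType d}
  {P : probability T R}.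
Variables (m : nat) (p r : R) (pim : 'I_N -> R) (q : probability nat R)
  (S : nat -> 'I_N -> {RV P >-> bool}) (D : 'I_N -> nat -> {RV P >-> nat})
  (a : nat -> T -> 'I_N) (sched : seq (seq (feedback N)) -> 'I_N).
Hypothesis hdl : downlink m p r pim q S D.
Hypothesis aE : follows sched m S D a.

(** Every heard slot yields an item of [arrived], so the slot given by [latest] is the smallest
    heard one, and no slot is heard when [latest] is [None]. *)
Lemma belief_heard i t w : (0 < t <= m)%N ->
  let E := heard_event m S i t w
    (fun k => (a k w == i) && (t + D (a k w) k w < k)%N) in
  P ([set v | S t i v] `&` E) =
  ((belief p r m pim t (arrived m S D a t w) i)%:E * P E)%E.
Proof.
move=> ht E; rewrite /belief.
case L : (latest _ i) => [[k f]|].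
  have [/mem_arrived[l hl [ai kl ->]] kmin] := latest_some _ _ _ _ L.
  rewrite -kl in ai hl * => {l kl}; rewrite -ai.
  apply: (cond_heard _ _ _ _ _ _ _ hdl) => //; first by lia.
    by apply/andP; split; [apply/eqP | lia].
  move=> s hs; apply/negP => /andP[/eqP ais hs'].
  have : (i, s, S s i w) \in arrived m S D a t w.
    by apply/mem_arrived; exists s; [lia | rewrite ais].
  by move/kmin => /(_ erefl); rewrite /fb_slot /=; lia.
apply: (cond_unheard _ _ _ _ _ _ _ hdl) => // s hs.
apply/negP => /andP[/eqP ais hs'].
have : (i, s, S s i w) \in arrived m S D a t w.
  by apply/mem_arrived; exists s; [lia | rewrite ais].
by move/latest_none: L => /[apply]; rewrite /fb_user eqxx.
Qed.

(** Independence factorises the probability of [G] with and without ON in slot [t]. The factors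
    differ only in the trajectory of user [i], where [belief_heard] supplies the belief. *)
Lemma cond_prob_history t i w : (0 < t <= m)%N ->
  let G := [set v | history m S D a t v = history m S D a t w] in
  P G != 0%E ->
  cond_prob (P := P) [set v | S t i v] G =
    belief p r m pim t (arrived m S D a t w) i.
Proof.
move=> ht G PG0.
pose arr k := (t + D (a k w) k w < k)%N.
pose heard j k := (a k w == j) && arr k.
pose traj j v := [ffun k : 'I_m => S k.+1 j v].
pose B j := [set x : {ffun 'I_m -> bool} | forall k : 'I_m,
  (t < k.+1)%N -> heard j k.+1 -> x k = S k.+1 j w].
(* Delays are pinned for feedback that has arrived in [w]; for the other scheduled slots they only
   have to be too long for an arrival before slot [t]. *)
pose C j (k : 'I_m) := [set n | (t < k.+1)%N -> a k.+1 w = j ->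
  if arr k.+1 then n = D j k.+1 w else ~~ (t + n < k.+1)%N].
have t1m : (t.-1 < m)%N by lia.
pose t1 := Ordinal t1m.
have t1E : t1.+1 = t by rewrite /=; lia.
(* For user [i] alone this adds ON in slot [t], which is the slot of the ordinal [t1]. *)
pose B' j := if j == i then B j `&` [set x : {ffun 'I_m -> bool} | x t1] else B j.
have GE : G = [set v | (forall j, B j (traj j v)) /\
                       forall j k, C j k (D j k.+1 v)].
  apply/seteqP; split=> v; rewrite /G /= (history_eq _ _ _ _ _ aE); try lia.
    move=> hv; split=> [j k tk /andP[/eqP aj hk]|j k tk aj];
      have km := ltn_ord k.
      rewrite ffunE -aj; have := hv k.+1 ltac:(lia).
      by rewrite /= ifT // => -[].
    have /= := hv k.+1 ltac:(lia); rewrite aj /arr aj.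
    by case: ifP => // _ [].
  move=> [hB hC] k hk.
  have k1m : (k.-1 < m)%N by lia.
  have k1E : (Ordinal k1m).+1 = k by rewrite /=; lia.
  have := hC (a k w) (Ordinal k1m); rewrite /C k1E => /(_ ltac:(lia) erefl).
  rewrite /arr; case: ifP => // hD Dk; split=> //.
  have := hB (a k w) (Ordinal k1m); rewrite ffunE k1E; apply; first by lia.
  by rewrite /heard eqxx.
have SGE : [set v | S t i v] `&` G =
    [set v | (forall j, B' j (traj j v)) /\ forall j k, C j k (D j k.+1 v)].
  rewrite GE; apply/seteqP; split=> v /=.
    move=> [Sv [hB hC]]; split=> // j; rewrite /B'; case: eqP => [->|//].
    by split=> //=; rewrite ffunE t1E.
  move=> [hB hC]; split; last first.
    by split=> // j; have := hB j; rewrite /B'; case: eqP => // _ [].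
  by have := hB i; rewrite /B' eqxx => -[_ /=]; rewrite ffunE t1E.
have BE j : [set v | B j (traj j v)] = heard_event m S j t w (heard j).
  apply/seteqP; split=> v hv.
    move=> s hs sh; have s1m : (s.-1 < m)%N by lia.
    have s1E : (Ordinal s1m).+1 = s by rewrite /=; lia.
    by have := hv (Ordinal s1m); rewrite ffunE s1E; apply=> //; lia.
  by move=> k tk hk; rewrite ffunE; apply: hv => //; have := ltn_ord k; lia.
have key : P [set v | B' i (traj i v)] =
    ((belief p r m pim t (arrived m S D a t w) i)%:E *
     P [set v | B i (traj i v)])%E.
  rewrite BE -belief_heard // -/heard -BE; congr (P _).
  rewrite /B' eqxx; apply/seteqP; split=> v /= [h1 h2]; split=> //.
    by rewrite ffunE t1E in h2.
  by rewrite ffunE t1E.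
have PSG : P ([set v | S t i v] `&` G) =
    ((belief p r m pim t (arrived m S D a t w) i)%:E * P G)%E.
  rewrite SGE GE (independence hdl B' C) (independence hdl B C).
  rewrite muleA (bigD1 i) //= key [in RHS](bigD1 i) //= muleA.
  do 2![congr (_ * _)%E]; apply: eq_bigr => j ji.
  by rewrite /B' (negbTE ji).
have mG : measurable G.
  rewrite (_ : G = (\bigcap_(j in [set: 'I_N]) [set v | B j (traj j v)]) `&`
      \bigcap_(j in [set: 'I_N]) \bigcap_(k in [set: 'I_m])
        (D j k.+1 @^-1` C j k)); last first.
    rewrite GE; apply/seteqP; split=> v [hB hC]; split.
    - by move=> j _; apply: hB.
    - by move=> j _ k _; apply: hC.
    - by move=> j; apply: hB.
    - by move=> j k; apply: (hC j I k I).
  apply: measurableI; apply: fin_bigcap_measurable; try exact: finite_finset.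
    by move=> j _; rewrite BE; apply: measurable_heard_event.
  move=> j _; apply: fin_bigcap_measurable; first exact: finite_finset.
  by move=> k _; apply: measurable_funPTI.
have PGfin : P G \is a fin_num by exact: fin_num_measure.
rewrite -(fineK PGfin) eqe in PG0.
by rewrite /cond_prob PSG fineM //= mulfK.
Qed.

End ConditionalBelief.

Theorem mainTheorem3 (R : realType) (N m : nat) (pim : 'I_N -> R)
    (hN : (0 < N)%N) (hpim : forall i, 0 <= pim i <= 1) :
  (forall (p r : R) (q : probability nat R)
      (d : measure_display) (T : measurableType d) (P : probability T R)
      (S : nat -> 'I_N -> {RV P >-> bool}) (D : 'I_N -> nat -> {RV P >-> nat})
      (a : nat -> T -> 'I_N) (sched : seq (seq (feedback N)) -> 'I_N),
    0 <= p <= 1 -> 0 <= r <= 1 -> r < p ->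
    downlink m p r pim q S D -> follows sched m S D a ->
    (* the beliefs are the conditional probabilities of the channels being ON
       given the feedback that has arrived *)
    (forall t i w, (0 < t <= m)%N ->
      let G := [set v | history m S D a t v = history m S D a t w] in
      P G != 0%E ->
      cond_prob (P := P) [set v | S t i v] G =
        belief p r m pim t (arrived m S D a t w) i) /\
    (* (1) *)
    (forall t w, (0 < t <= m)%N ->
      let H := arrived m S D a t w in
      (exists i, greedy_rule pim H i) /\
      (forall i, greedy_rule pim H i -> is_greedy p r m pim t H i)) /\
    (* (2) *)
    (forall t w, (0 < t <= m)%N ->
      let H := arrived m S D a t w in
      (exists L, is_ordering pim H L) /\
      (forall L, is_ordering pim H L ->
        [/\ perm_eq (full_list L) (enum 'I_N),
            sorted (fun i j => belief p r m pim t H j <= belief p r m pim t H i)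
                   (full_list L)
          & exists2 i, ohead (full_list L) = Some i
                     & is_greedy p r m pim t H i])) /\
    (* (3) *)
    (forall t w L, (1 < t <= m)%N ->
      is_ordering pim (arrived m S D a t w) L ->
      is_ordering pim (arrived m S D a t.-1 w)
        (update (arrived m S D a t w) (arriving m S D a t w) L))) /\
  (* one scheduler, chosen before p, r and the delay law q, is greedy whatever
     these are *)
  (exists sched : seq (seq (feedback N)) -> 'I_N,
    forall (p r : R) (q : probability nat R)
      (d : measure_display) (T : measurableType d) (P : probability T R)
      (S : nat -> 'I_N -> {RV P >-> bool}) (D : 'I_N -> nat -> {RV P >-> nat})
      (a : nat -> T -> 'I_N),
    0 <= p <= 1 -> 0 <= r <= 1 -> r < p ->
    downlink m p r pim q S D -> follows sched m S D a ->
    forall t w, (0 < t <= m)%N ->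
      is_greedy p r m pim t (arrived m S D a t w) (a t w)).
Proof.
split; last first.
  (* The rule reads only [pim] and the flattened history, so this choice precedes [p], [r] and [q].
     The default [Ordinal hN] is never returned as a default, because the rule can always be
     satisfied. *)
  exists (fun h => xget (Ordinal hN) [set i | greedy_rule pim (flatten h) i]).
  move=> p r q d T P S D a hp hr hrp hdl aE t w ht.
  apply: greedy_rule_greedy => //; first exact: arrived_slots.
  rewrite (aE t w ht); exact: (xgetPex (Ordinal hN) (greedy_rule_exists pim _ hN)).
move=> p r q d T P S D a sched hp hr hrp hdl aE; split; [|split; [|split]].
- by move=> t i w ht G; apply: cond_prob_history hdl aE _ _ _ ht.
- move=> t w ht H; split; first exact: greedy_rule_exists.
  by move=> i; apply: greedy_rule_greedy => // x; apply: arrived_slots.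
- move=> t w ht H; split; first exact: ordering_exists.
  move=> L HL; have bL : sorted (fun i j =>
      belief p r m pim t H j <= belief p r m pim t H i) (full_list L).
    by apply: ordering_sorted HL => // x; apply: arrived_slots.
  split=> //; first exact: ordering_perm HL.
  exact: ordering_head_greedy HL bL.
move=> t w L ht HL; have t0 : (0 < t <= m)%N by lia.
rewrite arrived_pred //; apply: update_ordering => //.
by rewrite -arrived_pred //; apply: arrived_consistent.
Qed.
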